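(* Let $R$ be an associative ring with identity. The following statements hold. (1) The Kleisli convolution representations of $R$ and their homomorphisms form an additive category $\mathsf{Klcrep}_{\mathbb Z}(R)$, and there is an additive equivalence $$\mathsf{Klcrep}_{\mathbb Z}(R)\simeq R\text{-}\mathsf{free}_{\mathbb Z},$$ where $R\text{-}\mathsf{free}_{\mathbb Z}$ is the full subcategory of finitely generated left $R$-modules whose underlying Abelian groups are free of finite rank. (2) Let $\mathscr T_R=(R\otimes_{\mathbb Z}-,\eta,\mu)$ be the monad on the category $\mathsf{Ab}$ of Abelian groups induced by $R$, and let $\mathsf{Ab}^{\mathscr T_R}$ be its Eilenberg--Moore category (which is equivalent to the category $R\text{-}\mathsf{Mod}$ of all left $R$-modules). Then there is a fully faithful functor $$\mathsf{Klcrep}_{\mathbb Z}(R)\to\mathsf{Ab}^{\mathscr T_R}.$$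
   Context: All modules are unital left modules, and ring homomorphisms are unital. Let $\mathbf 1=\{\bullet\}$, and for a finite set $X$ put $E_X=X\times X$. **Free Abelian group monad.** For a set $X$, $\mathcal M_{\mathbb Z}(X)$ is the set of finite formal sums $\sum_{x\in X}a_x[x]$, $a_x\in\mathbb Z$. With $\mathcal M_{\mathbb Z}(f)(\sum a_x[x])=\sum a_x[f(x)]$, unit $x\mapsto[x]$ and multiplication $\sum_\ell c_\ell[\sum_x a_{\ell,x}[x]]\mapsto\sum_x(\sum_\ell c_\ell a_{\ell,x})[x]$ this is a monad $\mathscr M_{\mathbb Z}$ on $\mathsf{Set}$. A Kleisli arrow $f:X\rightsquigarrow Y$ is a map $f:X\to\mathcal M_{\mathbb Z}(Y)$, $f(x)=\sum_y f_{y,x}[y]$; its matrix is $[f]=(f_{y,x})$, Kleisli composition satisfies $[h\circ_{\mathsf{Kl}}f]=[h][f]$, and the Kleisli identity has identity matrix. For finite $X$, $\mathbb H_{\mathbb Z}(X)=\mathrm{Hom}_{\mathsf{Kl}(\mathscr M_{\mathbb Z})}(\mathbf 1,E_X)$ is a ring with pointwise addition and multiplication the Kleisli convolution (the Kleisli composite of $\mathbf 1\cong\mathbf 1\times\mathbf 1$, the Kleisli tensor product $f\otimes g$, and $m_X$, where $m_X((i,j),(p,q))=[(i,q)]$ if $j=p$ and $0$ otherwise), with unit $u_X(\bullet)=\sum_{x\in X}[(x,x)]$. The map $\Phi_X:\mathbb H_{\mathbb Z}(X)\to\mathrm{Mat}_X(\mathbb Z)$, $\Phi_X(f)=(f_{i,j})_{i,j\in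 X}$ where $f(\bullet)=\sum f_{i,j}[(i,j)]$, is an isomorphism of rings onto the $X\times X$ integer matrices with ordinary multiplication. **Kleisli convolution representations of $R$.** Such a representation is a pair $(X,\varrho)$ with $X$ a finite set and $\varrho:R\to\mathbb H_{\mathbb Z}(X)$ a unital ring homomorphism. A homomorphism $(X,\varrho_X)\to(Y,\varrho_Y)$ is a Kleisli arrow $f:X\rightsquigarrow Y$ in $\mathsf{Kl}(\mathscr M_{\mathbb Z})$ such that $\Phi_Y(\varrho_Y(r))[f]=[f]\Phi_X(\varrho_X(r))$ for all $r\in R$. Composition is Kleisli composition; morphisms are added via their matrices. **The monad $\mathscr T_R$.** It has endofunctor $M\mapsto R\otimes_{\mathbb Z}M$ on $\mathsf{Ab}$, unit $m\mapsto 1_R\otimes m$ and multiplication $r\otimes s\otimes m\mapsto rs\otimes m$. Its Eilenberg--Moore category has as objects the $\mathscr T_R$-algebras, i.e. pairs $(M,\alpha)$ with $\alpha:R\otimes_{\mathbb Z}M\to M$ satisfying the unit and associativity laws, and as morphisms the homomorphisms of Abelian groups compatible with structure maps. *)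

(* Defs.v *)
From HB Require Import structures.
From mathcomp Require Import all_boot all_algebra.
From mathcomp Require Import boolp.
From mathcomp Require Import freeg.

Set Implicit Arguments.
Unset Strict Implicit.
Unset Printing Implicit Defensive.

Import GRing.Theory.

Local Open Scope ring_scope.
Local Open Scope quotient_scope.

Record category := Category {
  ob :> Type;
  hom : ob -> ob -> Type;
  idc : forall a, hom a a;
  ccomp : forall a b c, hom b c -> hom a b -> hom a c;
  ccomp1f : forall a b (f : hom a b), ccomp (idc b) f = f;
  ccompf1 : forall a b (f : hom a b), ccomp f (idc a) = f;
  ccompA : forall a b c d (h : hom c d) (g : hom b c) (f : hom a b),
    ccomp h (ccomp g f) = ccomp (ccomp h g) f
}.
Arguments hom {_} a b.
Arguments idc {_} a.
Arguments ccomp {_ _ _ _} g f.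

Notation "g ∘ f" := (ccomp g f) (at level 40, left associativity).

Record functor (C D : category) := Functor {
  fobj :> C -> D;
  fmap : forall a b, hom a b -> hom (fobj a) (fobj b);
  fmap1 : forall a, fmap (idc a) = idc (fobj a);
  fmapM : forall a b c (g : hom b c) (f : hom a b),
    fmap (g ∘ f) = fmap g ∘ fmap f
}.
Arguments fmap {_ _} _ {_ _} _.

Definition idF (C : category) : functor C C :=
  @Functor C C id (fun a b f => f) (fun=> erefl) (fun _ _ _ _ _ => erefl).

Section FunctorComposition.
Variables (C D E : category) (G : functor D E) (F : functor C D).

Lemma compF_subproof1 (a : C) : fmap G (fmap F (idc a)) = idc (G (F a)).
Proof. by rewrite !fmap1. Qed.

Lemma compF_subproof2 (a b c : C) (g : hom b c) (f : hom a b) :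
  fmap G (fmap F (g ∘ f)) = fmap G (fmap F g) ∘ fmap G (fmap F f).
Proof. by rewrite !fmapM. Qed.

Definition compF : functor C E :=
  Functor compF_subproof1 compF_subproof2.

End FunctorComposition.

Definition is_iso (C : category) (a b : C) (f : hom a b) : Prop :=
  exists g : hom b a, g ∘ f = idc a /\ f ∘ g = idc b.

Definition nat_iso (C D : category) (F G : functor C D) : Prop :=
  exists t : forall a, hom (F a) (G a),
    (forall a, is_iso (t a)) /\
    (forall a b (f : hom a b), t b ∘ fmap F f = fmap G f ∘ t a).

Definition is_equivalence (C D : category) (F : functor C D) : Prop :=
  exists G : functor D C,
    nat_iso (compF G F) (idF C) /\ nat_iso (compF F G) (idF D).

Definition equivalent_categories (C D : category) : Prop :=
  exists F : functor C D, is_equivalence F.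

Definition fully_faithful (C D : category) (F : functor C D) : Prop :=
  forall a b : C, bijective (fun f : hom a b => fmap F f).

Record preadditive := Preadditive {
  pob :> Type;
  phom : pob -> pob -> zmodType;
  pid : forall a, phom a a;
  pcomp : forall a b c, phom b c -> phom a b -> phom a c;
  pcomp1f : forall a b (f : phom a b), pcomp (pid b) f = f;
  pcompf1 : forall a b (f : phom a b), pcomp f (pid a) = f;
  pcompA : forall a b c d (h : phom c d) (g : phom b c) (f : phom a b),
    pcomp h (pcomp g f) = pcomp (pcomp h g) f;
  pcompDl : forall a b c (g g' : phom b c) (f : phom a b),
    pcomp (g + g') f = pcomp g f + pcomp g' f;
  pcompDr : forall a b c (g : phom b c) (f f' : phom a b),
    pcomp g (f + f') = pcomp g f + pcomp g f'
}.
Arguments phom {_} a b.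
Arguments pid {_} a.
Arguments pcomp {_ _ _ _} g f.

Coercion category_of_preadditive (C : preadditive) : category :=
  @Category C (fun a b => phom a b) (@pid C) (@pcomp C)
    (@pcomp1f C) (@pcompf1 C) (@pcompA C).

Definition additive_functor (C D : preadditive) (F : functor C D) : Prop :=
  forall (a b : C) (f g : phom a b),
    fmap F (f + g) = (fmap F f : phom _ _) + (fmap F g : phom _ _).

Definition zero_object (C : category) (z : C) : Prop :=
  forall a : C, (exists! f : hom a z, True) /\ (exists! f : hom z a, True).

Definition has_biproduct (C : preadditive) (a b : C) : Prop :=
  exists (s : C) (i1 : phom a s) (i2 : phom b s) (p1 : phom s a)
         (p2 : phom s b),
    [/\ pcomp p1 i1 = pid a, pcomp p2 i2 = pid b,
        pcomp p1 i2 = 0, pcomp p2 i1 = 0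
      & pcomp i1 p1 + pcomp i2 p2 = pid s].

Definition is_additive_category (C : preadditive) : Prop :=
  (exists z : C, @zero_object C z) /\ (forall a b : C, has_biproduct a b).

Section FullSubcategory.
Variables (C : preadditive) (P : C -> Prop).

Record full_sub_ob := FullSubOb { fs_val :> C; fs_prop : P fs_val }.

Definition full_sub : preadditive :=
  @Preadditive full_sub_ob (fun a b => phom (fs_val a) (fs_val b))
    (fun a => pid (fs_val a)) (fun a b c g f => pcomp g f)
    (fun _ _ => @pcomp1f C _ _) (fun _ _ => @pcompf1 C _ _)
    (fun _ _ _ _ => @pcompA C _ _ _ _)
    (fun _ _ _ => @pcompDl C _ _ _) (fun _ _ _ => @pcompDr C _ _ _).

End FullSubcategory.

Record monad (C : category) := Monad {
  mfun :> functor C C;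
  meta : forall a, hom a (mfun a);
  mmu : forall a, hom (mfun (mfun a)) (mfun a);
  meta_nat : forall a b (f : hom a b), fmap mfun f ∘ meta a = meta b ∘ f;
  mmu_nat : forall a b (f : hom a b),
    fmap mfun f ∘ mmu a = mmu b ∘ fmap mfun (fmap mfun f);
  mmu_etal : forall a, mmu a ∘ meta (mfun a) = idc (mfun a);
  mmu_etar : forall a, mmu a ∘ fmap mfun (meta a) = idc (mfun a);
  mmuA : forall a, mmu a ∘ fmap mfun (mmu a) = mmu a ∘ mmu (mfun a)
}.

Section Kleisli.
Variables (C : category) (T : monad C).

Definition kl_hom (a b : C) : Type := hom a (T b).

Definition kl_comp (a b c : C) (g : kl_hom b c) (f : kl_hom a b) :
  kl_hom a c := mmu T c ∘ (fmap T g ∘ f).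

Lemma kl_comp1f a b (f : kl_hom a b) : kl_comp (meta T b) f = f.
Proof. by rewrite /kl_comp ccompA mmu_etar ccomp1f. Qed.

Lemma kl_compf1 a b (f : kl_hom a b) : kl_comp f (meta T a) = f.
Proof. by rewrite /kl_comp meta_nat ccompA mmu_etal ccomp1f. Qed.

Lemma kl_compA a b c d (h : kl_hom c d) (g : kl_hom b c) (f : kl_hom a b) :
  kl_comp h (kl_comp g f) = kl_comp (kl_comp h g) f.
Proof.
rewrite /kl_comp !fmapM !ccompA; congr (_ ∘ _ ∘ _).
by rewrite mmuA -!ccompA; congr (_ ∘ _); rewrite mmu_nat.
Qed.

Definition Kleisli : category :=
  @Category C kl_hom (meta T) kl_comp kl_comp1f kl_compf1 kl_compA.

End Kleisli.

Section EilenbergMoore.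
Variables (C : category) (T : monad C).

Record em_alg := EMAlg {
  em_car : C;
  em_str : hom (T em_car) em_car;
  em_unit : em_str ∘ meta T em_car = idc em_car;
  em_assoc : em_str ∘ fmap T em_str = em_str ∘ mmu T em_car
}.

Record em_hom (A B : em_alg) := EMHom {
  em_arr : hom (em_car A) (em_car B);
  em_comm : em_arr ∘ em_str A = em_str B ∘ fmap T em_arr
}.

Lemma em_homP A B (f g : em_hom A B) : em_arr f = em_arr g -> f = g.
Proof.
case: f g => [f hf] [g hg] /= efg; case: _ / efg in hg *.
by rewrite (Prop_irrelevance hf hg).
Qed.

Lemma em_id_subproof A :
  idc (em_car A) ∘ em_str A = em_str A ∘ fmap T (idc (em_car A)).
Proof. by rewrite fmap1 ccomp1f ccompf1. Qed.

Definition em_id A : em_hom A A := EMHom (em_id_subproof A).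

Lemma em_comp_subproof A B D (g : em_hom B D) (f : em_hom A B) :
  (em_arr g ∘ em_arr f) ∘ em_str A = em_str D ∘ fmap T (em_arr g ∘ em_arr f).
Proof. by rewrite fmapM ccompA -em_comm -!ccompA em_comm. Qed.

Definition em_comp A B D (g : em_hom B D) (f : em_hom A B) : em_hom A D :=
  EMHom (em_comp_subproof g f).

Lemma em_comp1f A B (f : em_hom A B) : em_comp (em_id B) f = f.
Proof. by apply: em_homP; rewrite /= ccomp1f. Qed.

Lemma em_compf1 A B (f : em_hom A B) : em_comp f (em_id A) = f.
Proof. by apply: em_homP; rewrite /= ccompf1. Qed.

Lemma em_compA A B D E (h : em_hom D E) (g : em_hom B D) (f : em_hom A B) :
  em_comp h (em_comp g f) = em_comp (em_comp h g) f.
Proof. by apply: em_homP; rewrite /= ccompA. Qed.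

Definition EilenbergMoore : category :=
  @Category em_alg em_hom em_id em_comp em_comp1f em_compf1 em_compA.

End EilenbergMoore.

(* Classically every type carries a choice structure (gen_choiceMixin), so
   choice types with arbitrary maps are the category of sets. *)
Definition SetCat : category :=
  @Category choiceType (fun X Y => X -> Y) (fun X x => x)
    (fun X Y Z g f x => g (f x)) (fun _ _ _ => erefl) (fun _ _ _ => erefl)
    (fun _ _ _ _ _ _ _ => erefl).

Definition fgsum (K : choiceType) (M : zmodType) (f : K -> M)
  (D : {freeg K}) : M := \sum_(k <- dom D) f k *~ coeff k D.

Section FgsumTheory.
Variables (K : choiceType) (M : zmodType).
Implicit Types f g : K -> M.

Lemma fgsumE f (D : {freeg K}) : fgsum f D = fglift (f : K -> zmodule M) D.
Proof.
rewrite -[in RHS](freeg_sumE D) /fgsum.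
have aL : zmod_morphism (fglift (f : K -> zmodule M)) by exact: lift_is_additive.
pose L : {additive {freeg K} -> zmodule M} :=
  HB.pack (fglift (f : K -> zmodule M)) (GRing.isZmodMorphism.Build _ _ _ aL).
rewrite -[RHS]/(L _) raddf_sum; apply: eq_bigr => k _.
by rewrite /L /= liftU scalezrE.
Qed.

Lemma fgsum_is_zmod_morphism f : zmod_morphism (fgsum f).
Proof. by move=> D E; rewrite !fgsumE lift_is_additive. Qed.

HB.instance Definition _ f :=
  GRing.isZmodMorphism.Build {freeg K} M (fgsum f) (fgsum_is_zmod_morphism f).

Lemma fgsumU f (c : int) k : fgsum f << c *g k >> = f k *~ c.
Proof. by rewrite fgsumE liftU scalezrE. Qed.

Lemma fgsumU1 f k : fgsum f << k >> = f k.
Proof. by rewrite fgsumU mulr1z. Qed.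

End FgsumTheory.

Lemma freeg_additive_ext (K : choiceType) (M : zmodType)
    (F G : {additive {freeg K} -> M}) :
  (forall k, F << k >> = G << k >>) -> F =1 G.
Proof.
move=> eFG D; rewrite -(freeg_sumE D) !raddf_sum; apply: eq_bigr => k _.
have -> : << coeff k D *g k >> = << k >> *~ coeff k D :> {freeg K}.
  by rewrite freegU_mulz intz.
by rewrite !raddfMz eFG.
Qed.

Section FreeAbelianGroupMonad.
Implicit Types X Y Z : choiceType.

Definition MZ_map X Y (f : X -> Y) : {freeg X} -> {freeg Y} :=
  fgsum (fun x => << f x >>).

HB.instance Definition _ X Y (f : X -> Y) :=
  GRing.Additive.on (MZ_map f).

Definition MZ_eta X (x : X) : {freeg X} := << x >>.

Definition MZ_mu X : {freeg {freeg X}} -> {freeg X} := fgsum id.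

HB.instance Definition _ X := GRing.Additive.on (@MZ_mu X).

Lemma MZ_mapU X Y (f : X -> Y) x : MZ_map f << x >> = << f x >>.
Proof. exact: fgsumU1. Qed.

Lemma MZ_muU X (D : {freeg X}) : MZ_mu << D >> = D.
Proof. exact: fgsumU1. Qed.

Lemma MZ_map1 X : MZ_map (@id X) = id.
Proof.
apply/funext=> D; apply: (@freeg_additive_ext _ _ (MZ_map id) idfun) => x.
exact: MZ_mapU.
Qed.

Lemma MZ_mapM X Y Z (g : Y -> Z) (f : X -> Y) :
  MZ_map (fun x => g (f x)) = fun D => MZ_map g (MZ_map f D).
Proof.
apply/funext=> D.
apply: (@freeg_additive_ext _ _ (MZ_map _) (MZ_map g \o MZ_map f)) => x.
by rewrite /= !MZ_mapU.
Qed.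

Definition MZ_functor : functor SetCat SetCat :=
  @Functor SetCat SetCat (fun X : choiceType => {freeg X} : choiceType)
    MZ_map MZ_map1 MZ_mapM.

Lemma MZ_eta_nat X Y (f : X -> Y) :
  (fun x => MZ_map f (MZ_eta x)) = (fun x => MZ_eta (f x)).
Proof. by apply/funext=> x; rewrite MZ_mapU. Qed.

Lemma MZ_mu_nat X Y (f : X -> Y) :
  (fun D => MZ_map f (MZ_mu D)) = (fun D => MZ_mu (MZ_map (MZ_map f) D)).
Proof.
apply/funext=> D.
apply: (@freeg_additive_ext _ _ (MZ_map f \o @MZ_mu X)
  (@MZ_mu Y \o MZ_map (MZ_map f))) => E.
by rewrite /= MZ_mapU !MZ_muU.
Qed.

Lemma MZ_mu_etal X : (fun D : {freeg X} => MZ_mu (MZ_eta D)) = id.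
Proof. by apply/funext=> D; rewrite MZ_muU. Qed.

Lemma MZ_mu_etar X : (fun D : {freeg X} => MZ_mu (MZ_map (@MZ_eta X) D)) = id.
Proof.
apply/funext=> D.
apply: (@freeg_additive_ext _ _ (@MZ_mu X \o MZ_map (@MZ_eta X)) idfun) => x.
by rewrite /= MZ_mapU MZ_muU.
Qed.

Lemma MZ_muA X :
  (fun D => MZ_mu (MZ_map (@MZ_mu X) D)) = (fun D => MZ_mu (MZ_mu D)).
Proof.
apply/funext=> D.
apply: (@freeg_additive_ext _ _ (@MZ_mu X \o MZ_map (@MZ_mu X))
  (@MZ_mu X \o @MZ_mu {freeg X})) => E.
by rewrite /= MZ_mapU !MZ_muU.
Qed.

Definition MZ : monad SetCat :=
  @Monad SetCat MZ_functor MZ_eta MZ_mu MZ_eta_nat MZ_mu_nat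
    MZ_mu_etal MZ_mu_etar MZ_muA.

End FreeAbelianGroupMonad.

Notation "X ~~> Y" := (@hom (Kleisli MZ) X Y)
  (at level 99, no associativity).

(* The Y x X matrix of f, its rows and columns being numbered by the
   enumerations of Y and X. *)
Definition kl_mx (X Y : finType) (f : X ~~> Y) : 'M[int]_(#|Y|, #|X|) :=
  \matrix_(i, j) coeff (enum_val i) (f (enum_val j)).

Section KleisliMatrices.
Implicit Types X Y Z : finType.

Lemma kl_arrowP X Y (f g : X ~~> Y) :
  (forall x y, coeff y (f x) = coeff y (g x)) <-> f = g.
Proof.
split=> [efg|-> //]; apply/funext=> x; apply/eqP/freeg_eqP => y.
exact: efg.
Qed.

Lemma kl_mx_inj X Y : injective (@kl_mx X Y).
Proof.
move=> f g /matrixP efg; apply/kl_arrowP => x y.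
have := efg (enum_rank y) (enum_rank x).
by rewrite !mxE !enum_rankK.
Qed.

Lemma freeg_sum_fin X (D : {freeg X}) (M : zmodType) (f : X -> M) :
  fgsum f D = \sum_x f x *~ coeff x D.
Proof.
rewrite /fgsum big_uniq ?uniq_dom //= [RHS](bigID [in dom D]) /=.
rewrite [X in _ = _ + X]big1 ?addr0 // => x /coeff_outdom ->.
by rewrite mulr0z.
Qed.

Lemma kl_compE X Y Z (g : Y ~~> Z) (f : X ~~> Y) x :
  (g ∘ f : X ~~> Z) x = fgsum g (f x).
Proof.
apply: (@freeg_additive_ext _ _ (@MZ_mu Z \o MZ_map g) (fgsum g)) => y.
by rewrite /= MZ_mapU MZ_muU fgsumU1.
Qed.

Lemma coeff_kl_comp X Y Z (g : Y ~~> Z) (f : X ~~> Y) x z :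
  coeff z ((g ∘ f : X ~~> Z) x) = \sum_y coeff z (g y) * coeff y (f x).
Proof.
rewrite kl_compE freeg_sum_fin raddf_sum; apply: eq_bigr => y _.
by rewrite raddfMz mulrzz.
Qed.

Lemma kl_mx_comp X Y Z (g : Y ~~> Z) (f : X ~~> Y) :
  kl_mx (g ∘ f : X ~~> Z) = kl_mx g *m kl_mx f.
Proof.
apply/matrixP=> i k; rewrite !mxE coeff_kl_comp.
rewrite (reindex _ (onW_bij _ (@enum_val_bij Y))) /=.
by apply: eq_bigr => j _; rewrite !mxE.
Qed.

Lemma kl_mx_id X : kl_mx (@idc (Kleisli MZ) X) = 1%:M.
Proof.
apply/matrixP=> i j; rewrite !mxE coeffU mul1r (inj_eq enum_val_inj).
by rewrite eq_sym.
Qed.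

End KleisliMatrices.

(* The tensor product has matrix entries
   (f ⊗ g)_((y, y'), (x, x')) = f_(y, x) g_(y', x'). *)
Definition kl_tensor (X X' Y Y' : choiceType) (f : X ~~> Y) (g : X' ~~> Y') :
    (X * X')%type ~~> (Y * Y')%type :=
  fun p => \sum_(y <- dom (f p.1)) \sum_(y' <- dom (g p.2))
    << coeff y (f p.1) * coeff y' (g p.2) *g (y, y') >>.

Definition kl_unitor : unit ~~> (unit * unit)%type := fun=> << (tt, tt) >>.

Definition E_ (X : finType) : finType := (X * X)%type.

Definition m_ (X : finType) : (E_ X * E_ X)%type ~~> E_ X :=
  fun p => if p.1.2 == p.2.1 then << (p.1.1, p.2.2) >> else 0.
Arguments m_ : clear implicits.

(* For empty X this is the zero ring, hence the use of pzRingType. *)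
Definition HZ (X : finType) : Type := unit ~~> E_ X.

Section ConvolutionRing.
Variable X : finType.
Implicit Types f g h : HZ X.

Definition HZ_zero : HZ X := fun=> 0.
Definition HZ_opp f : HZ X := fun t => - f t.
Definition HZ_add f g : HZ X := fun t => f t + g t.

Definition HZ_conv f g : HZ X := m_ X ∘ (kl_tensor f g ∘ kl_unitor).

Definition HZ_one : HZ X := fun=> \sum_(x : X) << (x, x) >>.

Definition Phi f : 'M[int]_#|X| :=
  \matrix_(i, j) coeff (enum_val i, enum_val j) (f tt).

Lemma HZ_addA : associative HZ_add.
Proof. by move=> f g h; apply/funext=> t; rewrite /HZ_add addrA. Qed.

Lemma HZ_addC : commutative HZ_add.
Proof. by move=> f g; apply/funext=> t; rewrite /HZ_add addrC. Qed.

Lemma HZ_add0 : left_id HZ_zero HZ_add.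
Proof. by move=> f; apply/funext=> t; rewrite /HZ_add add0r. Qed.

Lemma HZ_addN : left_inverse HZ_zero HZ_opp HZ_add.
Proof. by move=> f; apply/funext=> t; rewrite /HZ_add addNr. Qed.

HB.instance Definition _ := gen_eqMixin (HZ X).
HB.instance Definition _ := gen_choiceMixin (HZ X).
HB.instance Definition _ :=
  GRing.isZmodule.Build (HZ X) HZ_addA HZ_addC HZ_add0 HZ_addN.

Lemma coeff_kl_tensor (U V U' V' : choiceType) (f : U ~~> V) (g : U' ~~> V')
    p y y' :
  coeff (y, y') (kl_tensor f g p) = coeff y (f p.1) * coeff y' (g p.2).
Proof.
rewrite raddf_sum /=.
have E (T : choiceType) (D : {freeg T}) t (F : T -> int) :
    \sum_(u <- dom D) F u * coeff u D * (u == t)%:R = F t * coeff t D.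
  have [tD|tD] := boolP (t \in dom D).
    rewrite (bigD1_seq t) ?uniq_dom //= eqxx mulr1 big1 ?addr0 // => u.
    by move/negPf->; rewrite mulr0.
  rewrite (coeff_outdom tD) mulr0 big_seq big1 // => u uD.
  by case: eqP uD tD => [-> ->|]; rewrite ?mulr0.
under eq_bigr => u _.
  rewrite raddf_sum /=.
  under eq_bigr => v _ do
    rewrite coeffU xpair_eqE -mulnb natrM mulrA mulrAC.
  rewrite -mulr_suml E.
  over.
under eq_bigr => u _ do rewrite [coeff u _ * _]mulrC.
by rewrite E mulrC.
Qed.

Lemma coeff_HZ_conv f g x z :
  coeff (x, z) (HZ_conv f g tt) =
  \sum_y coeff (x, y) (f tt) * coeff (y, z) (g tt).
Proof.
rewrite /HZ_conv (@coeff_kl_comp unit (E_ X * E_ X)%type (E_ X)).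
have tE p : coeff p ((kl_tensor f g ∘ kl_unitor : _ ~~> _) tt) =
    coeff p.1 (f tt) * coeff p.2 (g tt).
  rewrite (@kl_compE unit (unit * unit)%type (E_ X * E_ X)%type) fgsumU1.
  by case: p => a b; rewrite coeff_kl_tensor.
under eq_bigr => p _ do rewrite tE.
rewrite -(pair_bigA _ (fun a b => coeff (x, z) (m_ X (a, b)) *
  (coeff a (f tt) * coeff b (g tt)))) /=.
under eq_bigr => a _.
  rewrite -(pair_bigA _ (fun b d => coeff (x, z) (m_ X (a, (b, d))) *
    (coeff a (f tt) * coeff (b, d) (g tt)))) /=.
  over.
rewrite -(pair_bigA _ (fun a c => \sum_b \sum_d
  coeff (x, z) (m_ X ((a, c), (b, d))) *
    (coeff (a, c) (f tt) * coeff (b, d) (g tt)))) /=.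
rewrite (bigD1 x) //= [X in _ + X]big1 ?addr0; last first.
  move=> a /negPf ax; rewrite big1 // => c _; rewrite big1 // => b _.
  rewrite big1 // => d _; rewrite /m_ /=; case: eqP => _; last first.
    by rewrite coeff0 mul0r.
  by rewrite coeffU xpair_eqE ax mulr0 mul0r.
apply: eq_bigr => c _.
rewrite (bigD1 c) //= [X in _ + X]big1 ?addr0; last first.
  move=> b /negPf bc; rewrite big1 // => d _.
  by rewrite /m_ /= eq_sym bc coeff0 mul0r.
rewrite (bigD1 z) //= [X in _ + X]big1 ?addr0; last first.
  move=> d /negPf dz.
  by rewrite /m_ /= eqxx coeffU xpair_eqE dz andbF mulr0 mul0r.
by rewrite /m_ /= eqxx coeffU eqxx !mul1r.
Qed.

Lemma Phi_inj : injective Phi.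
Proof.
move=> f g /matrixP efg; apply/kl_arrowP => -[] [x y].
have := efg (enum_rank x) (enum_rank y).
by rewrite !mxE !enum_rankK.
Qed.

Lemma Phi_is_zmod_morphism : zmod_morphism Phi.
Proof. by move=> f g; apply/matrixP=> i j; rewrite !mxE coeffB. Qed.

Lemma PhiM f g : Phi (HZ_conv f g) = Phi f *m Phi g.
Proof.
apply/matrixP=> i k; rewrite !mxE coeff_HZ_conv.
rewrite (reindex _ (onW_bij _ (@enum_val_bij X))) /=.
by apply: eq_bigr => j _; rewrite !mxE.
Qed.

Lemma Phi1 : Phi HZ_one = 1%:M.
Proof.
apply/matrixP=> i j; rewrite !mxE raddf_sum /=.
rewrite (reindex _ (onW_bij _ (@enum_val_bij X))) (bigD1 i) //= big1 ?addr0.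
  by rewrite coeffU mul1r xpair_eqE eqxx (inj_eq enum_val_inj).
move=> k /negPf ki.
by rewrite coeffU xpair_eqE (inj_eq enum_val_inj) ki mulr0.
Qed.

Lemma PhiD : {morph Phi : f g / f + g}.
Proof. by move=> f g; apply/matrixP=> i j; rewrite !mxE coeffD. Qed.

Lemma HZ_convA : associative HZ_conv.
Proof. by move=> f g h; apply: Phi_inj; rewrite !PhiM mulmxA. Qed.

Lemma HZ_conv1f : left_id HZ_one HZ_conv.
Proof. by move=> f; apply: Phi_inj; rewrite PhiM Phi1 mul1mx. Qed.

Lemma HZ_convf1 : right_id HZ_one HZ_conv.
Proof. by move=> f; apply: Phi_inj; rewrite PhiM Phi1 mulmx1. Qed.

Lemma HZ_convDl : left_distributive HZ_conv +%R.
Proof. by move=> f g h; apply: Phi_inj; rewrite !(PhiM, PhiD) mulmxDl. Qed.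

Lemma HZ_convDr : right_distributive HZ_conv +%R.
Proof. by move=> f g h; apply: Phi_inj; rewrite !(PhiM, PhiD) mulmxDr. Qed.

HB.instance Definition _ := GRing.Zmodule_isPzRing.Build (HZ X)
  HZ_convA HZ_conv1f HZ_convf1 HZ_convDl HZ_convDr.

Lemma Phi_is_monoid_morphism : monoid_morphism Phi.
Proof. by split; [exact: Phi1 | exact: PhiM]. Qed.

HB.instance Definition _ :=
  GRing.isZmodMorphism.Build (HZ X) 'M[int]_#|X| Phi Phi_is_zmod_morphism.
HB.instance Definition _ :=
  GRing.isMonoidMorphism.Build (HZ X) 'M[int]_#|X| Phi Phi_is_monoid_morphism.

Lemma Phi_bij : bijective Phi.
Proof.
pose U (c : int) (q : E_ X) : {freeg E_ X} := << c *g q >>.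
have cU p c q : coeff p (U c q) = c * (q == p)%:R by exact: coeffU.
pose h (A : 'M[int]_#|X|) : HZ X := fun=>
  \sum_i \sum_j U (A i j) (enum_val i, enum_val j).
have hK A : Phi (h A) = A.
  apply/matrixP=> i j; rewrite mxE raddf_sum (bigD1 i) //= [X in _ + X]big1 ?addr0.
    rewrite raddf_sum (bigD1 j) //= cU eqxx mulr1 big1 ?addr0 // => l /negPf lj.
    by rewrite cU xpair_eqE !(inj_eq enum_val_inj) lj andbF mulr0.
  move=> k /negPf ki; rewrite raddf_sum big1 // => l _ /=.
  by rewrite cU xpair_eqE (inj_eq enum_val_inj) ki mulr0.
by exists h => // f; apply: Phi_inj; rewrite hK.
Qed.

End ConvolutionRing.

Section KleisliRepresentations.
Variable R : pzRingType.

Record klrep := KlRep {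
  kl_set : finType;
  kl_rho : {rmorphism R -> HZ kl_set}
}.

Record klrep_hom (A B : klrep) := KlRepHom {
  kl_arr : kl_set A ~~> kl_set B;
  kl_intertwine : forall r : R,
    Phi (kl_rho B r) *m kl_mx kl_arr = kl_mx kl_arr *m Phi (kl_rho A r)
}.

Lemma klrep_homP A B (f g : klrep_hom A B) : kl_arr f = kl_arr g -> f = g.
Proof.
case: f g => [f hf] [g hg] /= efg; case: _ / efg in hg *.
by rewrite (Prop_irrelevance hf hg).
Qed.

Lemma klrep_hom_mxP A B (f g : klrep_hom A B) :
  kl_mx (kl_arr f) = kl_mx (kl_arr g) -> f = g.
Proof. by move=> /kl_mx_inj; exact: klrep_homP. Qed.

Section AdditionOfMorphisms.
Variables A B : klrep.
Implicit Types f g h : klrep_hom A B.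

Definition kl_add_arr (f g : kl_set A ~~> kl_set B) : kl_set A ~~> kl_set B :=
  fun x => f x + g x.
Definition kl_opp_arr (f : kl_set A ~~> kl_set B) : kl_set A ~~> kl_set B :=
  fun x => - f x.
Definition kl_zero_arr : kl_set A ~~> kl_set B := fun=> 0.

Lemma kl_mx_add (f g : kl_set A ~~> kl_set B) :
  kl_mx (kl_add_arr f g) = kl_mx f + kl_mx g.
Proof. by apply/matrixP=> i j; rewrite !mxE coeffD. Qed.

Lemma kl_mx_opp (f : kl_set A ~~> kl_set B) :
  kl_mx (kl_opp_arr f) = - kl_mx f.
Proof. by apply/matrixP=> i j; rewrite !mxE coeffN. Qed.

Lemma kl_mx_zero : kl_mx kl_zero_arr = 0.
Proof. by apply/matrixP=> i j; rewrite !mxE coeff0. Qed.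

Lemma klrep_add_subproof f g (r : R) (a := kl_add_arr (kl_arr f) (kl_arr g)) :
  Phi (kl_rho B r) *m kl_mx a = kl_mx a *m Phi (kl_rho A r).
Proof. by rewrite kl_mx_add mulmxDr mulmxDl !kl_intertwine. Qed.

Lemma klrep_opp_subproof f (r : R) (a := kl_opp_arr (kl_arr f)) :
  Phi (kl_rho B r) *m kl_mx a = kl_mx a *m Phi (kl_rho A r).
Proof. by rewrite kl_mx_opp mulmxN mulNmx kl_intertwine. Qed.

Lemma klrep_zero_subproof (r : R) :
  Phi (kl_rho B r) *m kl_mx kl_zero_arr = kl_mx kl_zero_arr *m Phi (kl_rho A r).
Proof. by rewrite kl_mx_zero mulmx0 mul0mx. Qed.

Definition klrep_add f g : klrep_hom A B := KlRepHom (klrep_add_subproof f g).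
Definition klrep_opp f : klrep_hom A B := KlRepHom (klrep_opp_subproof f).
Definition klrep_zero : klrep_hom A B := KlRepHom klrep_zero_subproof.

Lemma klrep_addA : associative klrep_add.
Proof. by move=> f g h; apply: klrep_hom_mxP; rewrite !kl_mx_add addrA. Qed.

Lemma klrep_addC : commutative klrep_add.
Proof. by move=> f g; apply: klrep_hom_mxP; rewrite !kl_mx_add addrC. Qed.

Lemma klrep_add0 : left_id klrep_zero klrep_add.
Proof.
by move=> f; apply: klrep_hom_mxP; rewrite !kl_mx_add kl_mx_zero add0r.
Qed.

Lemma klrep_addN : left_inverse klrep_zero klrep_opp klrep_add.
Proof.
move=> f; apply: klrep_hom_mxP.
by rewrite !kl_mx_add kl_mx_opp kl_mx_zero addNr.
Qed.

HB.instance Definition _ := gen_eqMixin (klrep_hom A B).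
HB.instance Definition _ := gen_choiceMixin (klrep_hom A B).
HB.instance Definition _ := GRing.isZmodule.Build (klrep_hom A B)
  klrep_addA klrep_addC klrep_add0 klrep_addN.

End AdditionOfMorphisms.

Lemma klrep_id_subproof A (r : R) (f := @idc (Kleisli MZ) (kl_set A)) :
  Phi (kl_rho A r) *m kl_mx f = kl_mx f *m Phi (kl_rho A r).
Proof. by rewrite kl_mx_id mulmx1 mul1mx. Qed.

Definition klrep_id A : klrep_hom A A := KlRepHom (@klrep_id_subproof A).

Lemma klrep_comp_subproof A B C (g : klrep_hom B C) (f : klrep_hom A B)
    (r : R) (h := kl_arr g ∘ kl_arr f) :
  Phi (kl_rho C r) *m kl_mx h = kl_mx h *m Phi (kl_rho A r).
Proof.
by rewrite kl_mx_comp mulmxA kl_intertwine -mulmxA kl_intertwine mulmxA.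
Qed.

Definition klrep_comp A B C (g : klrep_hom B C) (f : klrep_hom A B) :
  klrep_hom A C := KlRepHom (klrep_comp_subproof g f).

Lemma klrep_comp1f A B (f : klrep_hom A B) : klrep_comp (klrep_id B) f = f.
Proof. by apply: klrep_homP; exact: (@ccomp1f (Kleisli MZ)). Qed.

Lemma klrep_compf1 A B (f : klrep_hom A B) : klrep_comp f (klrep_id A) = f.
Proof. by apply: klrep_homP; exact: (@ccompf1 (Kleisli MZ)). Qed.

Lemma klrep_compA A B C D (h : klrep_hom C D) (g : klrep_hom B C)
    (f : klrep_hom A B) :
  klrep_comp h (klrep_comp g f) = klrep_comp (klrep_comp h g) f.
Proof. by apply: klrep_homP; exact: (@ccompA (Kleisli MZ)). Qed.

Lemma klrep_compDl A B C (g g' : klrep_hom B C) (f : klrep_hom A B) :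
  klrep_comp (g + g') f = klrep_comp g f + klrep_comp g' f.
Proof.
by apply: klrep_hom_mxP; rewrite kl_mx_add !kl_mx_comp kl_mx_add mulmxDl.
Qed.

Lemma klrep_compDr A B C (g : klrep_hom B C) (f f' : klrep_hom A B) :
  klrep_comp g (f + f') = klrep_comp g f + klrep_comp g f'.
Proof.
by apply: klrep_hom_mxP; rewrite kl_mx_add !kl_mx_comp kl_mx_add mulmxDr.
Qed.

Definition Klcrep : preadditive :=
  @Preadditive klrep (fun A B => klrep_hom A B : zmodType)
    klrep_id klrep_comp klrep_comp1f klrep_compf1 klrep_compA
    klrep_compDl klrep_compDr.

End KleisliRepresentations.

Lemma additive_ext (M N : zmodType) (f g : {additive M -> N}) :
  f =1 g -> f = g.
Proof.
case: f g => [f [[mf]]] [g [[mg]]] /= /funext efg.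
by case: _ / efg in mg *; rewrite (Prop_irrelevance mf mg).
Qed.

Section Modules.
Variable R : pzRingType.

Lemma linear_ext (M N : lmodType R) (f g : {linear M -> N}) : f =1 g -> f = g.
Proof.
case: f g => [f [[mf] [nf]]] [g [[mg] [ng]]] /= /funext efg.
case: _ / efg in mg ng *.
by rewrite (Prop_irrelevance mf mg) (Prop_irrelevance nf ng).
Qed.

Definition lin (M N : lmodType R) : Type := {linear M -> N}.

Section LinearMaps.
Variables M N : lmodType R.
Implicit Types f g h : {linear M -> N}.

Definition lin_zero : lin M N := \0.
Definition lin_opp f : lin M N := \- f.
Definition lin_add f g : lin M N := f \+ g.

Lemma lin_addA : associative (lin_add : lin M N -> lin M N -> lin M N).
Proof. by move=> f g h; apply: linear_ext => x; rewrite /= addrA. Qed.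

Lemma lin_addC : commutative (lin_add : lin M N -> lin M N -> lin M N).
Proof. by move=> f g; apply: linear_ext => x; rewrite /= addrC. Qed.

Lemma lin_add0 : left_id lin_zero (lin_add : lin M N -> lin M N -> lin M N).
Proof. by move=> f; apply: linear_ext => x; rewrite /= add0r. Qed.

Lemma lin_addN : left_inverse lin_zero (lin_opp : lin M N -> lin M N)
  (lin_add : lin M N -> lin M N -> lin M N).
Proof. by move=> f; apply: linear_ext => x; rewrite /= addNr. Qed.

HB.instance Definition _ := gen_eqMixin (lin M N).
HB.instance Definition _ := gen_choiceMixin (lin M N).
HB.instance Definition _ :=
  GRing.isZmodule.Build (lin M N) lin_addA lin_addC lin_add0 lin_addN.

End LinearMaps.

Definition lin_id (M : lmodType R) : lin M M := idfun.

Definition lin_comp (M N P : lmodType R) (g : {linear N -> P})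
  (f : {linear M -> N}) : lin M P := g \o f.

Lemma lin_comp1f (M N : lmodType R) (f : lin M N) : lin_comp (lin_id N) f = f.
Proof. exact: linear_ext. Qed.

Lemma lin_compf1 (M N : lmodType R) (f : lin M N) : lin_comp f (lin_id M) = f.
Proof. exact: linear_ext. Qed.

Lemma lin_compA (M N P Q : lmodType R) (h : lin P Q) (g : lin N P)
    (f : lin M N) : lin_comp h (lin_comp g f) = lin_comp (lin_comp h g) f.
Proof. exact: linear_ext. Qed.

Lemma lin_compDl (M N P : lmodType R) (g g' : lin N P) (f : lin M N) :
  lin_comp (g + g') f = lin_comp g f + lin_comp g' f.
Proof. exact: linear_ext. Qed.

Lemma lin_compDr (M N P : lmodType R) (g : lin N P) (f f' : lin M N) :
  lin_comp g (f + f') = lin_comp g f + lin_comp g f'.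
Proof. by apply: linear_ext => x; exact: (linearD (g : {linear N -> P})). Qed.

Definition Mod : preadditive :=
  @Preadditive (lmodType R) (fun M N => lin M N : zmodType)
    lin_id lin_comp lin_comp1f lin_compf1 lin_compA lin_compDl lin_compDr.

Definition finitely_generated (M : lmodType R) : Prop :=
  exists (n : nat) (s : 'I_n -> M),
    forall m : M, exists c : 'I_n -> R, m = \sum_i c i *: s i.

Definition free_of_finite_rank (M : zmodType) : Prop :=
  exists (n : nat) (e : 'I_n -> M),
    forall m : M, exists! c : {ffun 'I_n -> int}, m = \sum_i e i *~ c i.

Definition Rfree : preadditive :=
  @full_sub Mod
    (fun M : lmodType R => finitely_generated M /\ free_of_finite_rank M).

End Modules.

Section Tensor.
Variables A M : zmodType.

(* The subgroup generated by the bilinearity relators: the quotient by it is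
   the tensor product over the integers. *)
Inductive tens_rel : {freeg (A * M)%type} -> Prop :=
| TensRel0 : tens_rel 0
| TensRelB D E : tens_rel D -> tens_rel E -> tens_rel (D - E)
| TensRelDl a a' m :
    tens_rel (<< (a + a', m) >> - << (a, m) >> - << (a', m) >>)
| TensRelDr a m m' :
    tens_rel (<< (a, m + m') >> - << (a, m) >> - << (a, m') >>).

Definition tens_null : {pred {freeg (A * M)%type}} :=
  fun D => `[< tens_rel D >].

Lemma tens_null_zmod_closed : zmod_closed tens_null.
Proof.
split=> [|D E /asboolP hD /asboolP hE]; apply/asboolP.
  exact: TensRel0.
exact: TensRelB.
Qed.

HB.instance Definition _ := GRing.isZmodClosed.Build {freeg (A * M)%type}
  tens_null tens_null_zmod_closed.

Definition tensor := Quotient.quot tens_null.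

HB.instance Definition _ := ZmodQuotient.on tensor.

Definition tens (a : A) (m : M) : tensor := \pi_tensor << (a, m) >>.

End Tensor.

Notation "a ⊗ m" := (tens a m) (at level 40, left associativity).

Definition biadditive (A M P : zmodType) (f : A -> M -> P) : Prop :=
  (forall a, zmod_morphism (f a)) /\ (forall m, zmod_morphism (f^~ m)).

Section TensorTheory.
Variables A M : zmodType.
Implicit Types (a : A) (m : M) (P : zmodType).

Lemma tens_rel_pi (D : {freeg (A * M)%type}) :
  tens_rel D -> \pi_(tensor A M) D = 0.
Proof.
move=> hD; have /eqP -> : D == 0 %[mod tensor A M].
  by rewrite -Quotient.idealrBE subr0; apply/asboolP.
exact: raddf0.
Qed.

Lemma tens_biadditive : biadditive (@tens A M).
Proof.
have DB (P Q : zmodType) (f : P -> Q) :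
    {morph f : x y / x + y} -> zmod_morphism f.
  by move=> fD x y; have := fD (x - y) y; rewrite subrK => ->; rewrite addrK.
split=> [a|m]; apply: DB => x y; apply/eqP; rewrite -subr_eq0 opprD addrA.
  by rewrite /tens -!(raddfB \pi_(tensor A M)) /= tens_rel_pi //; exact: TensRelDr.
by rewrite /tens -!(raddfB \pi_(tensor A M)) /= tens_rel_pi //; exact: TensRelDl.
Qed.

Lemma tensDl a a' m : (a + a') ⊗ m = a ⊗ m + a' ⊗ m.
Proof.
have := tens_biadditive.2 m (a + a') a'.
by rewrite /= addrK => ->; rewrite subrK.
Qed.

Lemma tensDr a m m' : a ⊗ (m + m') = a ⊗ m + a ⊗ m'.
Proof.
have := tens_biadditive.1 a (m + m') m'.
by rewrite /= addrK => ->; rewrite subrK.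
Qed.

Lemma tensor_ext P (F G : {additive tensor A M -> P}) :
  (forall a m, F (a ⊗ m) = G (a ⊗ m)) -> F = G.
Proof.
move=> eFG; apply: additive_ext => t; rewrite -[t]reprK.
apply: (@freeg_additive_ext _ _ (F \o \pi_(tensor A M)) (G \o \pi_(tensor A M))).
by case=> a m; exact: eFG.
Qed.

(* Only meaningful for biadditive f: it then sends a ⊗ m to f a m. *)
Definition tens_lift P (f : A -> M -> P) (t : tensor A M) : P :=
  fgsum (fun p => f p.1 p.2) (repr t).

Section Lift.
Variables (P : zmodType) (f : A -> M -> P) (bf : biadditive f).

Lemma tens_lift_pi D : tens_lift f (\pi_(tensor A M) D) =
  fgsum (fun p => f p.1 p.2) D.
Proof.
have vanish E : tens_rel E -> fgsum (fun p => f p.1 p.2) E = 0.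
  have add0 (Q : zmodType) (g : Q -> P) x y : zmod_morphism g ->
      g (x + y) - g x - g y = 0.
    by move=> gB; have := gB (x + y) x; rewrite addrC addKr => ->; exact: subrr.
  elim=> [|D1 D2 _ h1 _ h2|a a' m|a m m']; rewrite ?raddf0 // !raddfB /=.
  - by rewrite h1 h2 subr0.
  - by rewrite !fgsumU1 /= (add0 _ (f^~ m)) //; exact: bf.2.
  - by rewrite !fgsumU1 /= (add0 _ (f a)) //; exact: bf.1.
apply/eqP; rewrite -subr_eq0 /tens_lift -raddfB; apply/eqP/vanish/asboolP.
have : repr (\pi_(tensor A M) D) == D %[mod tensor A M] by rewrite reprK.
by rewrite -Quotient.idealrBE.
Qed.

Lemma tens_lift_is_zmod_morphism : zmod_morphism (tens_lift f).
Proof.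
move=> t u; rewrite -[t]reprK -[u]reprK -raddfB !tens_lift_pi.
exact: raddfB.
Qed.

Definition tens_lift_add : {additive tensor A M -> P} :=
  HB.pack (tens_lift f)
    (GRing.isZmodMorphism.Build _ _ _ tens_lift_is_zmod_morphism).

Lemma tens_liftE a m : tens_lift_add (a ⊗ m) = f a m.
Proof. by rewrite /= tens_lift_pi fgsumU1. Qed.

End Lift.
End TensorTheory.

Definition add_id (M : zmodType) : {additive M -> M} := idfun.

Definition add_comp (M N P : zmodType) (g : {additive N -> P})
  (f : {additive M -> N}) : {additive M -> P} := g \o f.

Lemma add_compE (M N P : zmodType) (g : {additive N -> P})
  (f : {additive M -> N}) m : add_comp g f m = g (f m).
Proof. by []. Qed.

Lemma add_comp1f (M N : zmodType) (f : {additive M -> N}) :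
  add_comp (add_id N) f = f.
Proof. exact: additive_ext. Qed.

Lemma add_compf1 (M N : zmodType) (f : {additive M -> N}) :
  add_comp f (add_id M) = f.
Proof. exact: additive_ext. Qed.

Lemma add_compA (M N P Q : zmodType) (h : {additive P -> Q})
    (g : {additive N -> P}) (f : {additive M -> N}) :
  add_comp h (add_comp g f) = add_comp (add_comp h g) f.
Proof. exact: additive_ext. Qed.

Definition Ab : category :=
  @Category zmodType (fun M N => {additive M -> N})
    add_id add_comp add_comp1f add_compf1 add_compA.

Section RingMonad.
Variable R : pzRingType.
Implicit Types M N P : zmodType.

Definition TR M : zmodType := tensor R M.

Lemma TR_map_subproof M N (f : {additive M -> N}) :
  biadditive (fun (r : R) m => r ⊗ f m).
Proof.
split=> [r x y|m x y]; first by rewrite raddfB (tens_biadditive _ _).1.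
exact: (tens_biadditive _ _).2.
Qed.

Definition TR_map M N (f : {additive M -> N}) : {additive TR M -> TR N} :=
  tens_lift_add (TR_map_subproof f).

Lemma TR_mapE M N (f : {additive M -> N}) r m : TR_map f (r ⊗ m) = r ⊗ f m.
Proof. exact: tens_liftE. Qed.

Definition TR_eta_fun M (m : M) : TR M := (1 : R) ⊗ m.

Lemma TR_eta_subproof M : zmod_morphism (@TR_eta_fun M).
Proof. exact: (tens_biadditive _ _).1. Qed.

HB.instance Definition _ M :=
  GRing.isZmodMorphism.Build M (TR M) (@TR_eta_fun M) (@TR_eta_subproof M).

Definition TR_eta M : {additive M -> TR M} := @TR_eta_fun M.

Lemma TR_mul_subproof M (r : R) : biadditive (fun (s : R) (m : M) => (r * s) ⊗ m).
Proof.
split=> [s x y|m x y]; first exact: (tens_biadditive _ _).1.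
by rewrite mulrBr (tens_biadditive _ _).2.
Qed.

Definition TR_mul M (r : R) : {additive TR M -> TR M} :=
  tens_lift_add (@TR_mul_subproof M r).

Lemma TR_mulE M (r s : R) (m : M) : TR_mul M r (s ⊗ m) = (r * s) ⊗ m.
Proof. exact: tens_liftE. Qed.

Lemma TR_mu_subproof M : biadditive (fun (r : R) (t : TR M) => TR_mul M r t).
Proof.
split=> [r|t r s]; first exact: raddfB.
suff -> : TR_mul M (r - s) = TR_mul M r \- TR_mul M s by [].
apply: tensor_ext => u m.
rewrite -[RHS]/(TR_mul M r (u ⊗ m) - TR_mul M s (u ⊗ m)).
by rewrite !TR_mulE mulrBl (tens_biadditive _ _).2.
Qed.

Definition TR_mu M : {additive TR (TR M) -> TR M} :=
  tens_lift_add (@TR_mu_subproof M).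

Lemma TR_muE1 M (r : R) (t : TR M) : TR_mu M (r ⊗ t) = TR_mul M r t.
Proof. exact: tens_liftE. Qed.

Lemma TR_muE M (r s : R) (m : M) : TR_mu M (r ⊗ (s ⊗ m)) = (r * s) ⊗ m.
Proof. by rewrite tens_liftE TR_mulE. Qed.

Lemma TR_map1 M : TR_map (add_id M) = add_id (TR M).
Proof. by apply: tensor_ext => r m; rewrite TR_mapE. Qed.

Lemma TR_mapM M N P (g : {additive N -> P}) (f : {additive M -> N}) :
  TR_map (add_comp g f) = add_comp (TR_map g) (TR_map f).
Proof. by apply: tensor_ext => r m; rewrite !(add_compE, TR_mapE). Qed.

Definition TR_functor : functor Ab Ab := @Functor Ab Ab TR TR_map TR_map1 TR_mapM.

Lemma TR_eta_nat M N (f : {additive M -> N}) :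
  add_comp (TR_map f) (TR_eta M) = add_comp (TR_eta N) f.
Proof. by apply: additive_ext => m; rewrite add_compE TR_mapE. Qed.

Lemma tensor2_ext M P (F G : {additive TR (TR M) -> P}) :
  (forall (r s : R) (m : M), F (r ⊗ (s ⊗ m)) = G (r ⊗ (s ⊗ m))) -> F = G.
Proof.
move=> eFG; apply: tensor_ext => r t.
have rB (H : {additive TR (TR M) -> P}) :
    zmod_morphism (fun t : TR M => H (r ⊗ t)).
  by move=> x y; rewrite (tens_biadditive _ _).1 raddfB.
pose ev (H : {additive TR (TR M) -> P}) : {additive TR M -> P} :=
  HB.pack (fun t : TR M => H (r ⊗ t)) (GRing.isZmodMorphism.Build _ _ _ (rB H)).
suff /(congr1 (fun H : {additive _ -> _} => H t)) : ev F = ev G by [].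
by apply: tensor_ext => s m; exact: eFG.
Qed.

Lemma TR_mu_nat M N (f : {additive M -> N}) :
  add_comp (TR_map f) (TR_mu M) = add_comp (TR_mu N) (TR_map (TR_map f)).
Proof.
by apply: tensor2_ext => r s m; rewrite !(add_compE, TR_muE, TR_mapE).
Qed.

Lemma TR_mu_etal M : add_comp (TR_mu M) (TR_eta (TR M)) = add_id (TR M).
Proof. by apply: tensor_ext => r m; rewrite add_compE TR_muE mul1r. Qed.

Lemma TR_mu_etar M : add_comp (TR_mu M) (TR_map (TR_eta M)) = add_id (TR M).
Proof. by apply: tensor_ext => r m; rewrite add_compE TR_mapE TR_muE mulr1. Qed.

Lemma TR_muA M :
  add_comp (TR_mu M) (TR_map (TR_mu M)) = add_comp (TR_mu M) (TR_mu (TR M)).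
Proof.
apply: tensor2_ext => r s t.
rewrite !(add_compE, TR_mapE, TR_muE) !TR_muE1.
suff -> : TR_mul M (r * s) = add_comp (TR_mul M r) (TR_mul M s) by [].
by apply: tensor_ext => u m; rewrite add_compE !TR_mulE mulrA.
Qed.

Definition TR_monad : monad Ab :=
  @Monad Ab TR_functor TR_eta TR_mu TR_eta_nat TR_mu_nat
    TR_mu_etal TR_mu_etar TR_muA.

End RingMonad.

(* Main.v *)
Require Import Defs.
From mathcomp Require Import all_boot all_algebra.
From HB Require Import structures.
From mathcomp Require Import boolp.
From mathcomp Require Import freeg.
(* Restores hom as the name for arrows of a category, which the theory of
   vector spaces also uses. *)
Import Defs.

Set Implicit Arguments.
Unset Strict Implicit.
Unset Printing Implicit Defensive.

Import GRing.Theory.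

Local Open Scope ring_scope.

(** A representation rho of R over the finite set X is, through the ring
isomorphism Phi, a ring homomorphism from R to square integer matrices, that
is, an R-module structure on the group of integer column vectors indexed by X;
an intertwining Kleisli arrow is the matrix of an R-linear map between two such
modules. This gives a functor from representations to modules
([klcol_functor]), and each assertion of the theorem comes down to a property
of it.

- It is fully faithful ([klcol_fully_faithful]): every additive map between
  groups of integer columns is multiplication by one matrix, every integer
  matrix comes from one Kleisli arrow, and linearity over R is the intertwining
  relation.
- It is essentially surjective onto the modules that are free of finite rank
  over the integers ([klcol_essentially_surjective]): in an integral basis, the
  scalars act by integer matrices, and these matrices form a representation of
  R that [rmorphism_Phi_lift] carries back along Phi.

A fully faithful, essentially surjective functor is an equivalence
([equivalence_ff_eso], by choice). Zero objects and biproducts are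
described by equations between arrows, so they can be pulled back along an
additive equivalence ([additive_category_reflect]). Hence the representations
form an additive category because the finite rank modules do
([Rfree_additive]): there the biproduct is the direct product.

For the second part, a structure map on R tensor M is the same thing as a
biadditive scalar multiplication of R on M, the two monad laws being the unit
and associativity laws of a module. So the functor from modules to algebras
([module_alg_functor]) is fully faithful and essentially surjective, and its
composite with the columns functor and the inclusion of the finite rank modules
is fully faithful. *)

(** * Equivalences and additivity of categories *)

Lemma bijective_cancel (A B : Type) (f : A -> B) :
  bijective f -> exists g, cancel f g /\ cancel g f.
Proof. by case=> g fK gK; exists g. Qed.

Definition essentially_surjective (C D : category) (F : functor C D) : Prop :=
  forall d : D, exists (c : C) (u : hom (F c) d), is_iso u.

Lemma fully_faithful_comp (C D E : category) (G : functor D E)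
    (F : functor C D) :
  fully_faithful G -> fully_faithful F -> fully_faithful (compF G F).
Proof. by move=> ffG ffF a b; exact: bij_comp (ffG _ _) (ffF _ _). Qed.

(** A quasi-inverse sends d to a chosen object c with F c isomorphic to d, and
an arrow to the preimage under F of its conjugate by the chosen isomorphisms.
All equations can then be checked after applying F, which is faithful. *)
Lemma equivalence_ff_eso (C D : category) (F : functor C D) :
  fully_faithful F -> essentially_surjective F -> is_equivalence F.
Proof.
move=> ffF esF.
have [L LP] : exists L : forall a b : C, hom (F a) (F b) -> hom a b,
    forall a b, cancel (fun f : hom a b => fmap F f) (L a b) /\
                cancel (L a b) (fun f : hom a b => fmap F f).
  pose S (a b : C) := cid (bijective_cancel (ffF a b)).
  by exists (fun a b => projT1 (S a b)) => a b; exact: projT2 (S a b).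
have FL a b (f : hom (F a) (F b)) : fmap F (L a b f) = f := (LP a b).2 f.
have Finj (a b : C) (f g : hom a b) : fmap F f = fmap F g -> f = g.
  exact: (can_inj (LP a b).1).
pose S d := cid (esF d).
pose G0 d : C := projT1 (S d).
pose T d := cid (projT2 (S d)).
pose e d : hom (F (G0 d)) d := projT1 (T d).
pose U d := cid (projT2 (T d)).
pose e' d : hom d (F (G0 d)) := projT1 (U d).
have e'e d : e' d ∘ e d = idc _ by case: (projT2 (U d)).
have ee' d : e d ∘ e' d = idc _ by case: (projT2 (U d)).
pose Gm d d' (f : hom d d') : hom (G0 d) (G0 d') := L _ _ (e' d' ∘ f ∘ e d).
have G1 d : Gm d d (idc d) = idc (G0 d).
  by apply: Finj; rewrite FL ccompf1 e'e fmap1.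
have GM a b c (g : hom b c) (f : hom a b) :
    Gm a c (g ∘ f) = Gm b c g ∘ Gm a b f.
  apply: Finj; rewrite fmapM !FL !ccompA.
  by rewrite -(ccompA (e' c ∘ g) (e b)) ee' ccompf1.
exists (Functor G1 GM); split.
  exists (fun a => L _ _ (e (F a))); split=> [a|a b f] /=.
    by exists (L _ _ (e' (F a))); split; apply: Finj; rewrite fmapM !FL fmap1.
  by apply: Finj; rewrite !fmapM !FL !ccompA ee' ccomp1f.
exists e; split=> [d|a b f] /=; first by exists (e' d).
by rewrite FL !ccompA ee' ccomp1f.
Qed.

Lemma equivalent_categories_sym (C D : category) :
  equivalent_categories C D -> equivalent_categories D C.
Proof. by case=> F [G [GF FG]]; exists G, F. Qed.

Lemma pcomp0l (C : preadditive) (a b c : C) (f : phom a b) :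
  pcomp (0 : phom b c) f = 0.
Proof. by apply: (addIr (pcomp 0 f)); rewrite -pcompDl !add0r. Qed.

Lemma pcomp0r (C : preadditive) (a b c : C) (g : phom b c) :
  pcomp g (0 : phom a b) = 0.
Proof. by apply: (addIr (pcomp g 0)); rewrite -pcompDr !add0r. Qed.

(** This turns the universal property into an equation, which additive functors
preserve and faithful ones reflect. *)
Lemma zero_objectP (C : preadditive) (z : C) :
  @zero_object C z <-> pid z = 0.
Proof.
split=> [/(_ z)[[f [_ uf]] _]|z0 a].
  by rewrite -(uf (pid z)) // -(uf 0).
split; exists 0; split=> // f _.
  by rewrite -(pcomp1f f) z0 pcomp0l.
by rewrite -(pcompf1 f) z0 pcomp0r.
Qed.

Lemma additive_functor0 (C D : preadditive) (F : functor C D) (a b : C) :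
  additive_functor F -> fmap F (0 : phom a b) = 0 :> phom (F a) (F b).
Proof.
move=> aF; apply: (addIr (fmap F (0 : phom a b) : phom (F a) (F b))).
by rewrite -aF !add0r.
Qed.

(** A zero object or a biproduct of D is isomorphic to the image of an object
of C; conjugating its structure arrows by that isomorphism and lifting them
along F gives arrows of C that satisfy the same equations, since F is faithful
and additive. *)
Lemma additive_category_reflect (C D : preadditive) (F : functor C D) :
  additive_functor F -> fully_faithful F -> essentially_surjective F ->
  is_additive_category D -> is_additive_category C.
Proof.
move=> aF ffF esF [[z z0] biD].
have Finj (a b : C) (f g : phom a b) :
    fmap F f = fmap F g :> phom (F a) (F b) -> f = g.
  by move=> efg; exact: (bij_inj (ffF a b)) efg.
have Fsurj (a b : C) (h : phom (F a) (F b)) :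
    exists f : phom a b, fmap F f = h.
  by have [g _ gK] := ffF a b; exists (g h); exact: gK.
have F1 (a : C) : fmap F (pid a) = pid (F a) by exact: (fmap1 F a).
have FM (a b c : C) (g : phom b c) (f : phom a b) :
  fmap F (pcomp g f) = pcomp (fmap F g) (fmap F f) by exact: (fmapM F g f).
split.
  have [c [u [v [vu _]]]] := esF z; exists c; apply/zero_objectP/Finj.
  rewrite additive_functor0 // F1 -[LHS]vu /= -(pcomp1f u).
  by move/zero_objectP: z0 => ->; rewrite pcomp0l pcomp0r.
move=> a b.
have [s [i1 [i2 [p1 [p2 [p11 p22 p12 p21 ip]]]]]] := biD (F a) (F b).
have [c [u [v [vu uv]]]] := esF s.
have [j1 Fj1] := Fsurj _ _ (pcomp v i1).
have [j2 Fj2] := Fsurj _ _ (pcomp v i2).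
have [q1 Fq1] := Fsurj _ _ (pcomp p1 u).
have [q2 Fq2] := Fsurj _ _ (pcomp p2 u).
have cancel_uv (x y : D) (p : phom s y) (i : phom x s) :
    pcomp (pcomp p u) (pcomp v i) = pcomp p i.
  by rewrite pcompA -(pcompA p) [pcomp u v]uv pcompf1.
exists c, j1, j2, q1, q2; split; apply: Finj;
  rewrite ?FM ?additive_functor0 ?F1 ?Fj1 ?Fj2 ?Fq1 ?Fq2 ?cancel_uv //.
rewrite aF !FM Fj1 Fj2 Fq1 Fq2 !pcompA -!(pcompA v) -pcompDr -pcompDl ip.
by rewrite pcomp1f; exact: vu.
Qed.

(** * Free abelian groups of finite rank *)

Section IntegralCombinations.
Variables (X : finType) (M : zmodType) (e : X -> M).

Definition Zcomb (a : {ffun X -> int}) : M := \sum_x e x *~ a x.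

Lemma Zcomb_is_zmod_morphism : zmod_morphism Zcomb.
Proof.
move=> a b; rewrite /Zcomb -sumrB; apply: eq_bigr => x _.
by rewrite !ffunE mulrzBr.
Qed.

HB.instance Definition _ :=
  GRing.isZmodMorphism.Build {ffun X -> int} M Zcomb Zcomb_is_zmod_morphism.

Lemma Zcomb_basisP :
  bijective Zcomb <-> forall m, exists! a, m = Zcomb a.
Proof.
split=> [[c aK mK] m|/choice[c cP]].
  by exists (c m); split=> [|a ->]; rewrite ?mK ?aK.
exists c => [a|m]; last by rewrite -(cP m).1.
by apply: (cP _).2.
Qed.

End IntegralCombinations.

(** Bases indexed by an arbitrary finite type spare renumberings: the direct
product of two free groups has a basis indexed by a disjoint sum, and the
matrices of a representation are indexed by its underlying set. *)
Lemma free_of_finite_rankP (M : zmodType) :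
  free_of_finite_rank M <->
  exists (X : finType) (e : X -> M), bijective (Zcomb e).
Proof.
split=> [[n [e he]]|[X [e bij_e]]].
  by exists 'I_n, e; apply/Zcomb_basisP.
exists #|X|, (e \o enum_val); apply/Zcomb_basisP.
pose f (a : {ffun 'I_#|X| -> int}) : {ffun X -> int} :=
  [ffun x => a (enum_rank x)].
have f_bij : bijective f.
  exists (fun b : {ffun X -> int} => [ffun i : 'I_#|X| => b (enum_val i)]);
    move=> a; apply/ffunP=> x.
    by rewrite !ffunE enum_valK.
  by rewrite !ffunE enum_rankK.
apply: (eq_bij (bij_comp bij_e f_bij)) => a /=.
rewrite /Zcomb (reindex _ (onW_bij _ (@enum_val_bij X))) /=.
by apply: eq_bigr => i _; rewrite ffunE enum_valK.
Qed.

Lemma free_prod (M N : zmodType) :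
  free_of_finite_rank M -> free_of_finite_rank N ->
  free_of_finite_rank (M * N)%type.
Proof.
move=> /free_of_finite_rankP[X [e [c eK cK]]].
move=> /free_of_finite_rankP[Y [f [d fK dK]]].
apply/free_of_finite_rankP.
pose g (z : X + Y) : M * N :=
  match z with inl x => (e x, 0) | inr y => (0, f y) end.
have gE a : Zcomb g a =
    (Zcomb e [ffun x => a (inl x)], Zcomb f [ffun y => a (inr y)]).
  rewrite /Zcomb big_sumType /= [LHS]surjective_pairing.
  rewrite !(raddfD fst) !(raddfD snd) !(raddf_sum fst) !(raddf_sum snd) /=.
  have mz1 (p : M * N) k : (p *~ k).1 = p.1 *~ k := raddfMz fst k p.
  have mz2 (p : M * N) k : (p *~ k).2 = p.2 *~ k := raddfMz snd k p.
  congr (_, _).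
    rewrite [X in _ + X]big1 ?addr0 => [|y _]; last by rewrite mz1 mul0rz.
    by apply: eq_bigr => x _; rewrite mz1 ffunE.
  rewrite [X in X + _]big1 ?add0r => [|x _]; last by rewrite mz2 mul0rz.
  by apply: eq_bigr => y _; rewrite mz2 ffunE.
exists (X + Y)%type, g.
exists (fun p => [ffun z =>
  match z with inl x => c p.1 x | inr y => d p.2 y end]).
  move=> a; rewrite gE /= eK fK; apply/ffunP=> -[x|y]; by rewrite !ffunE.
move=> [m n]; rewrite gE /=; congr (_, _).
  by rewrite -[RHS]cK; congr Zcomb; apply/ffunP=> x; rewrite !ffunE.
by rewrite -[RHS]dK; congr Zcomb; apply/ffunP=> x; rewrite !ffunE.
Qed.

Section FreeModules.
Variable R : pzRingType.

Lemma free_finitely_generated (M : lmodType R) :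
  free_of_finite_rank M -> finitely_generated M.
Proof.
case=> n [e he]; exists n, e => m; have [a [mE _]] := he m.
exists (fun i => (a i)%:~R); rewrite mE.
by apply: eq_bigr => i _; rewrite scaler_int.
Qed.

Definition rfree_ob (M : lmodType R) (fM : free_of_finite_rank M) : Rfree R :=
  FullSubOb (C := Mod R) (conj (free_finitely_generated fM) fM).

Section ProductInjections.
Variables M N : lmodType R.

Definition pair_left (m : M) : M * N := (m, 0).
Definition pair_right (n : N) : M * N := (0, n).

Lemma pair_left_is_linear : linear pair_left.
Proof.
by move=> r x y; apply/eqP; rewrite xpair_eqE /= scaler0 addr0 !eqxx.
Qed.

Lemma pair_right_is_linear : linear pair_right.
Proof.
by move=> r x y; apply/eqP; rewrite xpair_eqE /= scaler0 addr0 !eqxx.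
Qed.

HB.instance Definition _ :=
  GRing.isLinear.Build R M (M * N)%type *:%R pair_left pair_left_is_linear.
HB.instance Definition _ :=
  GRing.isLinear.Build R N (M * N)%type *:%R pair_right pair_right_is_linear.

End ProductInjections.

Lemma Rfree_biproduct (M N : lmodType R)
    (pM : finitely_generated M /\ free_of_finite_rank M)
    (pN : finitely_generated N /\ free_of_finite_rank N) :
  has_biproduct (FullSubOb (C := Mod R) pM : Rfree R)
                (FullSubOb (C := Mod R) pN : Rfree R).
Proof.
exists (rfree_ob (free_prod pM.2 pN.2)).
exists (@pair_left M N : {linear _ -> _}), (@pair_right M N : {linear _ -> _}).
exists (fst : {linear (M * N)%type -> M}), (snd : {linear (M * N)%type -> N}).
split; apply: linear_ext => //= -[m n].
by apply/eqP; rewrite xpair_eqE /= addr0 add0r !eqxx.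
Qed.

Lemma Rfree_additive : is_additive_category (Rfree R).
Proof.
split.
  have f0 : free_of_finite_rank ('rV[R]_0).
    apply/free_of_finite_rankP; exists void, (fun=> 0).
    exists (fun=> [ffun=> 0]) => a; first by apply/ffunP => -[].
    by rewrite [LHS]thinmx0 [RHS]thinmx0.
  exists (rfree_ob f0); apply/zero_objectP; apply: linear_ext => x /=.
  by rewrite [x]thinmx0.
move=> [M pM] [N pN]; exact: Rfree_biproduct.
Qed.

End FreeModules.

(** * Convolution representations as modules of column vectors *)

Lemma kl_mx_surj (X Y : finType) (A : 'M[int]_(#|Y|, #|X|)) :
  exists f : X ~~> Y, kl_mx f = A.
Proof.
exists (fun x => \sum_y << A (enum_rank y) (enum_rank x) *g y >> : {freeg Y}).
apply/matrixP=> i j; rewrite mxE raddf_sum (bigD1 (enum_val i)) //=.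
rewrite coeffU eqxx mulr1 !enum_valK big1 ?addr0 // => y /negPf yi.
by rewrite coeffU yi mulr0.
Qed.

Lemma mulmx_ext (n m : nat) (A B : 'M[int]_(m, n)) :
  (forall v : 'cV_n, A *m v = B *m v) -> A = B.
Proof.
move=> eAB; apply/matrixP=> i j.
by have /colP/(_ i) := eAB (delta_mx j 0); rewrite -!colE !mxE.
Qed.

Lemma scale_intE (m n : nat) (k : int) (A : 'M[int]_(m, n)) : k *: A = A *~ k.
Proof. by rewrite -scaler_int intz. Qed.

Lemma additive_mulmx (n m : nat) (f : {additive 'cV[int]_n -> 'cV[int]_m}) :
  exists A : 'M_(m, n), forall v, f v = A *m v.
Proof.
exists (\matrix_(i, j) f (delta_mx j 0) i 0) => v.
rewrite [in LHS](matrix_sum_delta v) raddf_sum; apply/colP=> i.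
rewrite summxE mxE; apply: eq_bigr => j _; rewrite big_ord1 mxE.
by rewrite scale_intE raddfMz -scale_intE mxE mulrC.
Qed.

(** The inverse of the bijective ring homomorphism Phi is again a ring
homomorphism. *)
Lemma rmorphism_Phi_lift (R : pzRingType) (X : finType)
    (A : {rmorphism R -> 'M[int]_#|X|}) :
  exists rho : {rmorphism R -> HZ X}, forall r, Phi (rho r) = A r.
Proof.
have [h PhiK hK] := Phi_bij X.
have aB : zmod_morphism (h \o A).
  by move=> r s; apply: Phi_inj; rewrite raddfB /= !hK raddfB.
have aM : monoid_morphism (h \o A).
  split=> [|r s]; apply: Phi_inj; rewrite /= ?(rmorphM (@Phi X)) /= !hK.
    by rewrite rmorph1 Phi1.
  exact: rmorphM.
pose rho : {rmorphism R -> HZ X} := HB.pack (h \o A)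
  (GRing.isZmodMorphism.Build _ _ _ aB) (GRing.isMonoidMorphism.Build _ _ _ aM).
by exists rho => r; rewrite /= hK.
Qed.

Section ColumnModule.
Variable R : pzRingType.

(** The group of columns gets a type of its own for each representation, since
its module structure over R depends on the representation. *)
Definition klcol (A : klrep R) : Type := 'cV[int]_#|kl_set A|.

HB.instance Definition _ A := GRing.Zmodule.on (klcol A).

Section Action.
Variable A : klrep R.
Implicit Types (r s : R) (v : klcol A).

Definition klcol_act r v : klcol A := Phi (kl_rho A r) *m v.

Lemma klcol_actA r s v : klcol_act r (klcol_act s v) = klcol_act (r * s) v.
Proof. by rewrite /klcol_act mulmxA rmorphM -PhiM. Qed.

Lemma klcol_act1 : left_id 1 klcol_act.
Proof. by move=> v; rewrite /klcol_act rmorph1 Phi1 mul1mx. Qed.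

Lemma klcol_actDr : right_distributive klcol_act +%R.
Proof. by move=> r v w; rewrite /klcol_act mulmxDr. Qed.

Lemma klcol_actDl v : {morph klcol_act^~ v : r s / r + s}.
Proof. by move=> r s; rewrite /klcol_act !raddfD /= mulmxDl. Qed.

HB.instance Definition _ := GRing.Zmodule_isLmodule.Build R (klcol A)
  klcol_actA klcol_act1 klcol_actDr klcol_actDl.

Lemma klcol_scaleE r v : r *: v = Phi (kl_rho A r) *m v :> 'cV_#|kl_set A|.
Proof. by []. Qed.

Lemma klcol_free : free_of_finite_rank (klcol A).
Proof.
apply/free_of_finite_rankP.
exists 'I_#|kl_set A|, (fun i => delta_mx i 0 : klcol A).
have combE a : Zcomb (fun i => delta_mx i 0 : klcol A) a = \col_i a i.
  rewrite [RHS]matrix_sum_delta; apply: eq_bigr => i _.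
  by rewrite big_ord1 mxE scale_intE.
exists (fun v => [ffun i => v i 0]) => [a|v]; rewrite combE.
  by apply/ffunP=> i; rewrite ffunE mxE.
by apply/colP=> i; rewrite mxE ffunE.
Qed.

End Action.

Section LinearMapOfMorphism.
Variables (A B : klrep R) (f : klrep_hom A B).

Definition klcol_map (v : klcol A) : klcol B := kl_mx (kl_arr f) *m v.

Lemma klcol_map_is_linear : linear klcol_map.
Proof.
move=> r v w; rewrite /klcol_map mulmxDr; congr (_ + _).
by rewrite !klcol_scaleE !mulmxA kl_intertwine.
Qed.

HB.instance Definition _ := GRing.isLinear.Build R (klcol A) (klcol B) *:%R
  klcol_map klcol_map_is_linear.

End LinearMapOfMorphism.

Definition klcol_ob (A : klrep R) : Rfree R := rfree_ob (klcol_free A).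

Definition klcol_hom (A B : klrep R) (f : klrep_hom A B) :
  lin (klcol A) (klcol B) := (klcol_map f : {linear _ -> _}).

Lemma klcol_hom1 A : klcol_hom (klrep_id A) = lin_id (klcol A).
Proof.
by apply: linear_ext => v /=; rewrite /klcol_map kl_mx_id mul1mx.
Qed.

Lemma klcol_homM A B C (g : klrep_hom B C) (f : klrep_hom A B) :
  klcol_hom (klrep_comp g f) = lin_comp (klcol_hom g) (klcol_hom f).
Proof.
by apply: linear_ext => v /=; rewrite /klcol_map kl_mx_comp mulmxA.
Qed.

Definition klcol_functor : functor (Klcrep R) (Rfree R) :=
  @Functor (Klcrep R) (Rfree R) klcol_ob klcol_hom klcol_hom1 klcol_homM.

Lemma klcol_additive : additive_functor klcol_functor.
Proof.
move=> A B f g; apply: linear_ext => v /=.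
by rewrite /klcol_map kl_mx_add mulmxDl.
Qed.

(** The matrix H of an R-linear map h intertwines the two actions because both
sides of the relation have the same effect on every column v, namely
h (r *: v). *)
Lemma klcol_fully_faithful : fully_faithful klcol_functor.
Proof.
move=> A B.
have surj (h : lin (klcol A) (klcol B)) : exists f, klcol_hom f = h.
  have [H hE] := additive_mulmx (h : {additive _ -> _}).
  have [f fE] := kl_mx_surj H.
  have fP r : Phi (kl_rho B r) *m kl_mx f = kl_mx f *m Phi (kl_rho A r).
    apply: mulmx_ext => v; rewrite -!mulmxA fE -hE -klcol_scaleE -linearZ.
    by rewrite hE.
  by exists (KlRepHom fP); apply: linear_ext => v; rewrite /= hE /klcol_map fE.
have [g gK] := choice surj.
exists g => // f; apply: klrep_hom_mxP; apply: mulmx_ext => v.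
exact: (congr1 (fun h : {linear klcol A -> klcol B} => h v) (gK _)).
Qed.

Lemma linear_bij_iso (M N : lmodType R) (f : {linear M -> N}) :
  bijective f -> exists g : {linear N -> M}, cancel f g /\ cancel g f.
Proof.
case=> g fK gK.
pose gl : {linear N -> M} := HB.pack g
  (GRing.isLinear.Build R N M *:%R g (can2_linear fK gK)).
by exists gl.
Qed.

Section MatricesInBasis.
Variables (M : lmodType R) (X : finType) (e : X -> M).
Variable (c : M -> {ffun X -> int}).
Hypotheses (eK : cancel (Zcomb e) c) (cK : cancel c (Zcomb e)).

Definition of_coords (v : 'cV[int]_#|X|) : M :=
  Zcomb e [ffun x => v (enum_rank x) 0].

Definition basis_mx (r : R) : 'M[int]_#|X| :=
  \matrix_(i, j) c (r *: e (enum_val j)) (enum_val i).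

Lemma of_coords_bij : bijective of_coords.
Proof.
exists (fun m => \col_i c m (enum_val i)) => [v|m].
  by apply/colP=> i; rewrite mxE eK ffunE enum_valK.
rewrite -[RHS]cK; congr Zcomb; apply/ffunP=> x.
by rewrite ffunE mxE enum_rankK.
Qed.

Lemma of_coords_is_zmod_morphism : zmod_morphism of_coords.
Proof.
move=> v w; rewrite /of_coords -raddfB; congr Zcomb.
by apply/ffunP=> x; rewrite !ffunE !mxE.
Qed.

(** The columns of the matrix of r are the coordinates of the r-multiples of
the basis, so it acts on coordinates as r acts on M. As [of_coords] is
bijective, this identity transfers the module axioms of M to the matrices:
they form a ring homomorphism from R. *)
Lemma of_coords_mul r v : of_coords (basis_mx r *m v) = r *: of_coords v.
Proof.
have rE y : r *: e y = \sum_x e x *~ basis_mx r (enum_rank x) (enum_rank y).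
  rewrite -[LHS]cK; apply: eq_bigr => x _.
  by rewrite mxE !enum_rankK.
have scaleMz m k : r *: (m *~ k) = (r *: m) *~ k := raddfMz ( *:%R r) k m.
rewrite /of_coords /Zcomb scaler_sumr.
under [RHS]eq_bigr => y _ do rewrite scaleMz rE mulrz_suml ffunE.
rewrite exchange_big /=; apply: eq_bigr => x _.
rewrite ffunE mxE (reindex _ (onW_bij _ (@enum_rank_bij X))) mulrz_sumr.
by apply: eq_bigr => y _; rewrite mulrzA.
Qed.

Lemma of_coords_inj_mx (A B : 'M[int]_#|X|) :
  (forall v, of_coords (A *m v) = of_coords (B *m v)) -> A = B.
Proof.
by move=> eAB; apply: mulmx_ext => v; apply: (bij_inj of_coords_bij).
Qed.

Lemma basis_mx_is_zmod_morphism : zmod_morphism basis_mx.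
Proof.
move=> r s; apply: of_coords_inj_mx => v.
by rewrite mulmxBl of_coords_is_zmod_morphism !of_coords_mul scalerBl.
Qed.

Lemma basis_mx_is_monoid_morphism : monoid_morphism basis_mx.
Proof.
split=> [|r s]; apply: of_coords_inj_mx => v.
  by rewrite mul1mx of_coords_mul scale1r.
by rewrite -mulmxA !of_coords_mul scalerA.
Qed.

Lemma basis_rep : exists A : klrep R,
  exists u : {linear klcol A -> M}, bijective u.
Proof.
pose B : {rmorphism R -> 'M[int]_#|X|} := HB.pack basis_mx
  (GRing.isZmodMorphism.Build _ _ _ basis_mx_is_zmod_morphism)
  (GRing.isMonoidMorphism.Build _ _ _ basis_mx_is_monoid_morphism).
have [rho rhoE] := rmorphism_Phi_lift B.
pose A := KlRep rho; exists A.
have uZ : scalable (of_coords : klcol A -> M).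
  by move=> r v; rewrite klcol_scaleE rhoE of_coords_mul.
pose u : {linear klcol A -> M} := HB.pack (of_coords : klcol A -> M)
  (GRing.isZmodMorphism.Build (klcol A) M _ of_coords_is_zmod_morphism)
  (GRing.isScalable.Build R (klcol A) M *:%R _ uZ).
by exists u; exact: of_coords_bij.
Qed.

End MatricesInBasis.

Lemma klcol_essentially_surjective : essentially_surjective klcol_functor.
Proof.
move=> [M [gM fM]].
have /free_of_finite_rankP[X [e [c eK cK]]] := fM.
have [A [u /linear_bij_iso[v [uK vK]]]] := basis_rep eK cK.
exists A, u, v; split; exact: linear_ext.
Qed.

End ColumnModule.

(** * Algebras of the monad as modules *)

Section ModulesAndAlgebras.
Variable R : pzRingType.

Section StructureMap.
Variable M : lmodType R.

Lemma scale_biadditive : biadditive (fun (r : R) (m : M) => r *: m).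
Proof. by split=> [r m n|m r s]; rewrite (scalerBr, scalerBl). Qed.

Definition scale_str : {additive TR R M -> M} := tens_lift_add scale_biadditive.

Lemma scale_strE r m : scale_str (r ⊗ m) = r *: m.
Proof. exact: tens_liftE. Qed.

Lemma scale_str_unit : add_comp scale_str (TR_eta R M) = add_id M.
Proof. by apply: additive_ext => m; rewrite add_compE scale_strE scale1r. Qed.

Lemma scale_str_assoc :
  add_comp scale_str (TR_map R scale_str) = add_comp scale_str (TR_mu R M).
Proof.
apply: tensor2_ext => r s m.
by rewrite !add_compE TR_mapE TR_muE !scale_strE scalerA.
Qed.

Definition module_alg : EilenbergMoore (TR_monad R) :=
  @EMAlg Ab (TR_monad R) M scale_str scale_str_unit scale_str_assoc.

End StructureMap.

Section MorphismOfAlgebras.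
Variables (M N : lmodType R) (f : {linear M -> N}).

Lemma linear_alg_comm : add_comp f (scale_str M) =
  add_comp (scale_str N) (TR_map R f).
Proof.
apply: tensor_ext => r m; rewrite !add_compE TR_mapE !scale_strE.
exact: (linearZZ f).
Qed.

Definition linear_alg_hom : em_hom (module_alg M) (module_alg N) :=
  @EMHom Ab (TR_monad R) (module_alg M) (module_alg N) f linear_alg_comm.

End MorphismOfAlgebras.

Lemma linear_alg_hom1 (M : lmodType R) :
  linear_alg_hom (lin_id M) = em_id (module_alg M).
Proof. by apply: em_homP; exact: additive_ext. Qed.

Lemma linear_alg_homM (M N P : lmodType R) (g : lin N P) (f : lin M N) :
  linear_alg_hom (lin_comp g f) =
  em_comp (linear_alg_hom g) (linear_alg_hom f).
Proof. by apply: em_homP; exact: additive_ext. Qed.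

Definition module_alg_functor : functor (Mod R) (EilenbergMoore (TR_monad R)) :=
  @Functor (Mod R) (EilenbergMoore (TR_monad R)) module_alg
    (fun M N (f : lin M N) => linear_alg_hom f)
    linear_alg_hom1 linear_alg_homM.

(** On a pure tensor of r and m, the condition on a homomorphism of algebras
says that it commutes with multiplication by r. *)
Lemma module_alg_fully_faithful : fully_faithful module_alg_functor.
Proof.
move=> M N.
have surj (h : em_hom (module_alg M) (module_alg N)) :
    exists f : lin M N, linear_alg_hom f = h.
  case: h => h hc; pose hf : {additive M -> N} := h.
  have hZ : scalable hf.
    have hcE t : hf (scale_str M t) = scale_str N (TR_map R hf t).
      exact: (congr1 (fun k : {additive TR R M -> N} => k t) hc).
    by move=> r m; have := hcE (r ⊗ m); rewrite TR_mapE !scale_strE.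
  pose f : {linear M -> N} := HB.pack (hf : M -> N)
    (GRing.Additive.on hf) (GRing.isScalable.Build R M N *:%R hf hZ).
  exists f; apply: em_homP; exact: additive_ext.
have [g gK] := choice surj.
exists g => // f; apply: linear_ext => m.
exact: (congr1 (fun k : em_hom (module_alg M) (module_alg N) =>
  (em_arr k : {additive M -> N}) m) (gK _)).
Qed.

Section ModuleOfAlgebra.
Variable A : EilenbergMoore (TR_monad R).
Let V : zmodType := em_car A.
Let str : {additive TR R V -> V} := em_str A.

(** The module built on V carries a group structure that agrees with V in its
carrier and operations, but is not convertible to the abstract structure V.
The algebras to compare thus have different underlying groups, and the
isomorphism between them is given by an identity map in each direction. *)
Definition alg_module : Type := V.

HB.instance Definition _ := GRing.Zmodule.on alg_module.

Definition alg_scale (r : R) (m : alg_module) : alg_module :=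
  str (r ⊗ (m : V)).

Lemma alg_scaleA r s m : alg_scale r (alg_scale s m) = alg_scale (r * s) m.
Proof.
have strA t : str (TR_map R str t) = str (TR_mu R V t).
  exact: (congr1 (fun k : {additive TR R (TR R V) -> V} => k t) (em_assoc A)).
by have := strA (r ⊗ (s ⊗ (m : V))); rewrite TR_mapE TR_muE.
Qed.

Lemma alg_scale1 : left_id 1 alg_scale.
Proof.
move=> m; exact: (congr1 (fun k : {additive V -> V} => k m) (em_unit A)).
Qed.

Lemma alg_scaleDr : right_distributive alg_scale +%R.
Proof.
move=> r m n; rewrite /alg_scale -(raddfD str); congr (str _).
exact: (@tensDr R V).
Qed.

Lemma alg_scaleDl m : {morph alg_scale^~ m : r s / r + s}.
Proof. by move=> r s; rewrite /alg_scale tensDl raddfD. Qed.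

HB.instance Definition _ := GRing.Zmodule_isLmodule.Build R alg_module
  alg_scaleA alg_scale1 alg_scaleDr alg_scaleDl.

Definition of_alg_module (m : alg_module) : V := m.
Definition to_alg_module (m : V) : alg_module := m.

Lemma of_alg_module_is_zmod_morphism : zmod_morphism of_alg_module.
Proof. by []. Qed.

Lemma to_alg_module_is_zmod_morphism : zmod_morphism to_alg_module.
Proof. by []. Qed.

HB.instance Definition _ := GRing.isZmodMorphism.Build alg_module V
  of_alg_module of_alg_module_is_zmod_morphism.
HB.instance Definition _ := GRing.isZmodMorphism.Build V alg_module
  to_alg_module to_alg_module_is_zmod_morphism.

Lemma of_alg_module_comm : add_comp of_alg_module (scale_str alg_module) =
  add_comp str (TR_map R of_alg_module).
Proof.
by apply: tensor_ext => r m; rewrite !add_compE TR_mapE scale_strE.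
Qed.

Lemma to_alg_module_comm : add_comp to_alg_module str =
  add_comp (scale_str alg_module) (TR_map R to_alg_module).
Proof.
by apply: tensor_ext => r m; rewrite !add_compE TR_mapE scale_strE.
Qed.

End ModuleOfAlgebra.

Lemma module_alg_essentially_surjective :
  essentially_surjective module_alg_functor.
Proof.
move=> A; pose MA := module_alg (alg_module A).
exists (alg_module A : lmodType R).
exists (@EMHom Ab (TR_monad R) MA A _ (of_alg_module_comm A)).
exists (@EMHom Ab (TR_monad R) A MA _ (to_alg_module_comm A)).
by split; apply: em_homP; exact: additive_ext.
Qed.

End ModulesAndAlgebras.

Theorem theorem2 (R : pzRingType) :
  (is_additive_category (Klcrep R) /\
   exists F : functor (Klcrep R) (Rfree R),
     additive_functor F /\ is_equivalence F) /\
  (equivalent_categories (EilenbergMoore (TR_monad R)) (Mod R) /\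
   exists G : functor (Klcrep R) (EilenbergMoore (TR_monad R)),
     fully_faithful G).
Proof.
have ff := @klcol_fully_faithful R; have es := @klcol_essentially_surjective R.
have ffA := @module_alg_fully_faithful R.
have esA := @module_alg_essentially_surjective R.
split; split.
- exact: additive_category_reflect (@klcol_additive R) ff es
    (@Rfree_additive R).
- exists (klcol_functor R); split; first exact: klcol_additive.
  exact: equivalence_ff_eso.
- apply: equivalent_categories_sym; exists (module_alg_functor R).
  exact: equivalence_ff_eso.
pose incl : functor (Rfree R) (Mod R) := @Functor (Rfree R) (Mod R)
  (fun M => fs_val M) (fun M N f => f) (fun=> erefl) (fun _ _ _ _ _ => erefl).
exists (compF (module_alg_functor R) (compF incl (klcol_functor R))).
apply: fully_faithful_comp ffA _; apply: fully_faithful_comp ff => M N.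
by exists id.
Qed.
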